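(* For $m\geq 2$, \begin{equation*} \Gamma_{i}^{\left[\substack{s\\ s+m}\right]\times k} = \begin{cases} 1 & \text{if } i=0,\ k\geq 1,\\ 21\cdot 2^{3i-4} - 3\cdot 2^{2i-3} & \text{if } 1\leq i\leq s-1,\ k>i,\\ 2^{k+s-1} + 21\cdot 2^{3s-4} - 11\cdot 2^{2s-3} & \text{if } i=s,\ k>s,\\ 3\cdot 2^{k-s+2i-3} + 21\cdot\left[2^{3i-4} - 2^{3i-s-4}\right] & \text{if } s+1\leq i\leq s+m-1,\ k>i,\\ 11\cdot 2^{k+s+2m-3} + 21\cdot 2^{3s+3m-4} - 53\cdot 2^{2s+3m-4} & \text{if } i=s+m,\ k>s+m,\\ 21\cdot\left[2^{k-2s+3i-m-4} + 2^{3i-4} - 5\cdot 2^{4i-2s-m-5}\right] & \text{if } s+m+1\leq i\leq 2s+m-1,\ k>i,\\ 2^{2k+2s+m-2} - 3\cdot 2^{k+4s+2m-4} + 2^{6s+3m-5} & \text{if } i=2s+m,\ k>2s+m. \end{cases} \end{equation*}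
   Context: $\Gamma_{i}^{\left[\substack{s\\ s+m}\right]\times k}$ denotes the number of rank $i$ matrices over $\mathbb{F}_2$ of the form $\left[\frac{A}{B}\right]$ where $A$ is an $s\times k$ persymmetric matrix and $B$ an $(s+m)\times k$ persymmetric matrix over $\mathbb{F}_2$. *)

(* Defs.v *)
From mathcomp Require Import all_boot all_order all_algebra.

Set Implicit Arguments.
Unset Strict Implicit.
Unset Printing Implicit Defensive.

Import GRing.Theory.

(* For possibly rectangular matrices, "persymmetric" means constant along the
   antidiagonals (i.e. Hankel), not symmetric about the antidiagonal. *)
Definition persymmetric (T : eqType) (m n : nat) : pred 'M[T]_(m, n) :=
  fun A => [forall i : 'I_m, forall j : 'I_n, forall i' : 'I_m, forall j' : 'I_n,
    (i + j == i' + j')%N ==> (A i j == A i' j')].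

Definition double_persymmetric (s m k : nat) : {set 'M['F_2]_(s + (s + m), k)} :=
  [set col_mx A B | A : 'M['F_2]_(s, k) in @persymmetric 'F_2 s k,
                    B : 'M['F_2]_(s + m, k) in @persymmetric 'F_2 (s + m) k].

Definition Gamma (s m k i : nat) : nat :=
  #|[set M in double_persymmetric s m k | \rank M == i]|.

(* Exponents are integers because some are negative for small s and i, e.g.
   3i - 4 at i = 1. *)
Definition pow2 (e : int) : rat := (2%:R ^ e)%R.

(* Main.v *)
(* A persymmetric block is the Hankel matrix of a sequence. For a sequence b of
   length N, the polynomials in the kernel of its Hankel matrices come from a
   rank-two lattice over F_2[x]; a reduced basis has degrees d <= e with
   d + e = N + 1, so that the kernel on k coordinates is
   g F[x]_{<k-d} + h F[x]_{<k-e} (directly). Counting pairs (kernel vector,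
   sequence) shows that exactly 4^r sequences have d <= r.
   Fix the sequence b of the longer block (t2 rows). On the kernel of that block,
   the shorter one (t1 rows) becomes a single Hankel matrix when d <= t2, and a
   pair of Hankel matrices, of sizes d - t2 and k - d by t1, when d > t2; the
   sequences so obtained are equidistributed. This gives a recursion for the
   number of pairs of given rank, in which k is replaced by t1, and all the
   closed forms are geometric sums; full rank is obtained by complement. *)
Require Import Defs.
From mathcomp Require Import all_boot all_order all_algebra.
From mathcomp Require Import mxabelem zify ring.

Set Implicit Arguments.
Unset Strict Implicit.
Unset Printing Implicit Defensive.

Import Order.TTheory GRing.Theory Num.Theory.
Local Open Scope ring_scope.

(** * Reduced bases of the rank-two polynomial lattice of a sequence *)

Section HankelKernel.

Variable F : fieldType.
Implicit Types (B g z h w p r u v : {poly F}).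

Lemma size_mulD_le p g a d : (size p <= a)%N -> (size g <= d.+1)%N ->
  (size (p * g)%R <= a + d)%N.
Proof.
move=> pa gd; have [->|p0] := eqVneq p 0; first by rewrite mul0r size_poly0.
have aux x y : (0 < x)%N -> (x <= a)%N -> (y <= d.+1)%N -> ((x + y).-1 <= a + d)%N by lia.
by apply: leq_trans (size_polyMleq _ _) (aux _ _ _ pa gd); rewrite size_poly_gt0.
Qed.

(** The pairs [(p, r)] with [p * B] congruent to [r] mod ['X^n] form a lattice of determinant
    ['X^n], so [rb_det] makes [(g, z)] and [(h, w)] a basis of it. The basis is reduced in the usual
    sense once [d + e = n]. *)
Record reduced_basis (n : nat) (B g z h w : {poly F}) (d e : nat) : Prop := ReducedBasis {
  rb_size_g : (size g <= d.+1)%N;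
  rb_size_z : (size z <= d.+1)%N;
  rb_size_h : (size h <= e.+1)%N;
  rb_size_w : (size w <= e.+1)%N;
  rb_mem1 : 'X^n %| g * B - z;
  rb_mem2 : 'X^n %| h * B - w;
  rb_det : exists2 c : F, c != 0 & g * w - h * z = c *: 'X^n }.

Lemma reduced_basis_sym n B g z h w d e :
  reduced_basis n B g z h w d e -> reduced_basis n B h w g z e d.
Proof.
case=> ? ? ? ? ? ? [c c0 E]; split=> //; exists (- c); first by rewrite oppr_eq0.
by rewrite scaleNr -E opprB.
Qed.

Lemma size_leS_coef0 p d : (size p <= d.+1)%N -> p`_d = 0 -> (size p <= d)%N.
Proof.
move=> sp p0; apply/leq_sizeP=> j; rewrite leq_eqVlt => /orP[/eqP<-//|dj].
by apply/leq_sizeP: dj.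
Qed.

Lemma coef_mul_top p g a d : (size p <= a.+1)%N -> (size g <= d.+1)%N ->
  (p * g)`_(a + d) = p`_a * g`_d.
Proof.
move=> pa gd; rewrite coefM (bigD1 (inord a)) //= inordK ?ltnS ?leq_addr //.
rewrite addKn big1 ?addr0 // => i; rewrite -val_eqE /= inordK ?ltnS ?leq_addr //.
move=> ia; have [lt|ge] := ltnP i a.
  by rewrite [g`_ _]nth_default ?mulr0 //; apply: leq_trans gd _; lia.
by rewrite [p`_ _]nth_default ?mul0r //; apply: leq_trans pa _; lia.
Qed.

(* While the leading vectors are dependent one of the two vectors can be
   shortened; once the degrees add up to that of the determinant, they are
   independent. *)
Lemma reduced_basis_exists n B g z h w d e : reduced_basis n B g z h w d e ->
  exists g' z' h' w' d' e', [/\ reduced_basis n B g' z' h' w' d' e',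
    (d' + e' = n)%N & (d' <= e')%N].
Proof.
have [m] := ubnP (d + e)%N; elim: m => // m IH in g z h w d e * => lem rb.
wlog de : g z h w d e lem rb / (d <= e)%N.
  move=> W; case/orP: (leq_total d e) => [|]; first exact: W rb.
  by apply: (W h w g z); [rewrite addnC | exact: reduced_basis_sym].
have [sg sz sh sw m1 m2 [c c0 E]] := rb.
have sdet : (size (g * w - h * z)%R <= (d + e).+1)%N.
  apply: leq_trans (size_polyD _ _) _; rewrite size_polyN geq_max.
  by rewrite -addSn size_mulD_le //= addSnnS addnC size_mulD_le.
have nde : (n <= d + e)%N by move: sdet; rewrite E size_scale // size_polyXn.
move: nde; rewrite leq_eqVlt => /orP[/eqP n_de|nde].
  by exists g, z, h, w, d, e; split.
have topE : g`_d * w`_e = h`_e * z`_d.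
  apply/eqP; rewrite -subr_eq0 -!coef_mul_top // (addnC e) -coefB E.
  by rewrite coefZ coefXn gtn_eqF // mulr0.
have [[l [lh lw]]|[g0 z0]] : (exists l, h`_e = l * g`_d /\ w`_e = l * z`_d) \/
    (g`_d = 0 /\ z`_d = 0).
- have [g0|g0] := eqVneq (g`_d) 0; last first.
    left; exists (h`_e / g`_d); rewrite divfK //; split=> //.
    by rewrite mulrAC -topE mulrC mulKf.
  have [z0|z0] := eqVneq (z`_d) 0; [by right | left; exists (w`_e / z`_d)].
  rewrite divfK // g0 mulr0; split=> //; apply/eqP.
  by rewrite -(inj_eq (mulIf z0)) -topE g0 !mul0r.
- have e0 : (0 < e)%N by lia.
  pose q : {poly F} := l *: 'X^(e - d).
  have coefq (r : {poly F}) : (q * r)`_e = l * r`_d.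
    by rewrite /q -scalerAl coefZ coefXnM ltnNge leq_subr /= subKn.
  have szq (r : {poly F}) : (size r <= d.+1)%N -> (size (q * r)%R <= e.+1)%N.
    move=> sr; rewrite /q -scalerAl; apply: leq_trans (size_scale_leq _ _) _.
    have -> : e.+1 = ((e - d).+1 + d)%N by lia.
    by apply: size_mulD_le; rewrite ?size_polyXn.
  have step (r r' : {poly F}) : (size r <= e.+1)%N -> (size r' <= d.+1)%N ->
      r`_e = l * r'`_d -> (size (r - q * r')%R <= e.-1.+1)%N.
    move=> sr sr' El; rewrite prednK //; apply: size_leS_coef0; last first.
      by rewrite coefB coefq El subrr.
    by apply: leq_trans (size_polyD _ _) _; rewrite size_polyN geq_max sr szq.
  apply: (IH g z (h - q * g) (w - q * z) d e.-1); first by lia.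
  split=> //; [exact: step|exact: step| |].
    rewrite (_ : _ - _ = (h * B - w) - q * (g * B - z)); last by ring.
    by rewrite dvdp_sub // dvdp_mull.
  by exists c => //; rewrite -E; ring.
- have d0 : (0 < d)%N.
    case: d sg sz {de lem rb sdet nde topE} g0 z0 => // sg sz g0 z0.
    move: (size_leS_coef0 sg g0) (size_leS_coef0 sz z0).
    rewrite !leqn0 !size_poly_eq0 => /eqP Eg /eqP Ez.
    move: E; rewrite Eg Ez mul0r mulr0 subr0 => /esym/eqP.
    by rewrite scaler_eq0 (negbTE c0) -size_poly_eq0 size_polyXn.
  apply: (IH g z h w d.-1 e); first by lia.
  by split=> //; [rewrite prednK //; apply: size_leS_coef0..|exists c].
Qed.

Lemma Xn_reduced_basis n B : (size B <= n.+1)%N ->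
  exists g z h w d e, [/\ reduced_basis n B g z h w d e,
    (d + e = n)%N & (d <= e)%N].
Proof.
(* The reduction starts from the basis [(1, B)], [(0, 'X^n)], both with degree bound [n]. *)
move=> sB; apply: (@reduced_basis_exists n B 1 B 0 'X^n n n); split=> //.
- by rewrite size_poly1.
- by rewrite size_poly0.
- by rewrite size_polyXn.
- by rewrite mul1r subrr dvdp0.
- by rewrite mul0r sub0r dvdpNr.
- by exists 1; rewrite ?oner_eq0 // scale1r mul1r mul0r subr0.
Qed.

Section Basis.

Variables (n : nat) (B g z h w : {poly F}) (d e : nat).
Hypothesis rb : reduced_basis n B g z h w d e.
Hypothesis den : (d + e = n)%N.

(** Cramer's rule: up to the scalar [c], the coordinates are [p * w - r * h] and [r * g - p * z]
    divided by ['X^n]. Both are divisible because [(p, r)] lies in the lattice, and [d + e = n]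
    turns their size bounds into [k - d] and [k - e]. *)
Lemma reduced_basis_span p r k : (size p <= k)%N -> (size r <= k)%N ->
  'X^n %| p * B - r ->
  exists u v, [/\ (size u <= k - d)%N, (size v <= k - e)%N & p = u * g + v * h].
Proof.
move=> sp sr pr; have [sg sz sh sw m1 m2 [c c0 E]] := rb.
have sdet (x y x' y' : {poly F}) l : (size x <= k)%N -> (size y <= k)%N ->
   (size x' <= l.+1)%N -> (size y' <= l.+1)%N ->
   (size (x * x' - y * y')%R <= k + l)%N.
  move=> *; apply: leq_trans (size_polyD _ _) _.
  by rewrite size_polyN geq_max !size_mulD_le.
have div (x : {poly F}) : 'X^n %| x -> exists2 u, x = u * 'X^n & (size u <= size x - n)%N.
  case/dvdpP=> u ->; exists u => //; have [->|u0] := eqVneq u 0.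
    by rewrite mul0r size_poly0.
  by rewrite size_mulXn // addKn.
have [u Eu su] : exists2 u, p * w - r * h = u * 'X^n & (size u <= k - d)%N.
  have /div[u Eu su] : 'X^n %| p * w - r * h.
    rewrite (_ : _ - _ = h * (p * B - r) - p * (h * B - w)); last by ring.
    by rewrite dvdp_sub // dvdp_mull.
  exists u => //; apply: leq_trans su _.
  by have := sdet p r w h e sp sr sw sh; lia.
have [v Ev sv] : exists2 v, r * g - p * z = v * 'X^n & (size v <= k - e)%N.
  have /div[v Ev sv] : 'X^n %| r * g - p * z.
    rewrite (_ : _ - _ = p * (g * B - z) - g * (p * B - r)); last by ring.
    by rewrite dvdp_sub // dvdp_mull.
  exists v => //; apply: leq_trans sv _.
  by have := sdet r p g z d sr sp sg sz; lia.
exists (c^-1 *: u), (c^-1 *: v); split.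
- exact: leq_trans (size_scale_leq _ _) su.
- exact: leq_trans (size_scale_leq _ _) sv.
- have X0 : 'X^n != 0 :> {poly F} by rewrite -size_poly_eq0 size_polyXn.
  apply: (mulIf X0); apply: (scalerI c0).
  rewrite -!scalerAl -scalerDr -scalerAl scalerA mulfV // scale1r.
  rewrite scalerAr -E mulrDl -[u * g * _]mulrAC -[v * h * _]mulrAC -Eu -Ev; ring.
Qed.

(** A relation between [g] and [h] makes [u * z + v * w] a multiple of ['X^n] of size at most
    [k <= n], hence zero; the nonzero determinant then kills [u] and [v]. *)
Lemma reduced_basis_free k u v : (k <= n)%N -> (size u <= k - d)%N ->
  (size v <= k - e)%N -> u * g + v * h = 0 -> u = 0 /\ v = 0.
Proof.
move=> kn su sv E0; have [sg sz sh sw m1 m2 [c c0 E]] := rb.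
have sm (x y : {poly F}) l : (size x <= k - l)%N -> (size y <= l.+1)%N -> (size (x * y)%R <= k)%N.
  move=> sx sy; have [kl|lk] := leqP k l.
    have /eqP-> : x == 0 by rewrite -size_poly_eq0 -leqn0 (leq_trans sx) // leqn0 subn_eq0.
    by rewrite mul0r size_poly0.
  by rewrite -(subnK (ltnW lk)); apply: size_mulD_le.
have w0 : u * z + v * w = 0.
  have : 'X^n %| u * z + v * w.
    rewrite (_ : _ + _ = (u * g + v * h) * B - (u * (g * B - z) + v * (h * B - w))); last by ring.
    by rewrite E0 mul0r sub0r dvdpNr dvdp_add // dvdp_mull.
  apply: contraTeq => nz; apply/negP=> /dvdp_leq-/(_ nz).
  rewrite size_polyXn ltnNge => /negP; apply; apply: leq_trans kn.
  by apply: leq_trans (size_polyD _ _) _; rewrite geq_max !(sm _ _ _ _ sz, sm _ _ _ _ sw).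
have det0 : c *: 'X^n != 0 :> {poly F} by rewrite scaler_eq0 (negbTE c0) -size_poly_eq0 size_polyXn.
split; apply: (mulIf det0); rewrite mul0r -E.
  rewrite (_ : u * _ = (u * g + v * h) * w - (u * z + v * w) * h); last by ring.
  by rewrite E0 w0 !mul0r subrr.
rewrite (_ : v * _ = (u * z + v * w) * g - (u * g + v * h) * z); last by ring.
by rewrite E0 w0 !mul0r subrr.
Qed.

End Basis.

(** * Hankel matrices and the polynomial description of their kernels *)

(* [y *m tmx g m n] is the product by [g] of the row [y], read as a polynomial;
   [tmx g m n *m a] is the sequence obtained by letting [g] act on the
   sequence [a], with ['X] acting as the shift. *)
Definition tmx g m n : 'M[F]_(m, n) := \matrix_(i, j) ('X^i * g)`_j.

Definition hank N k t (a : 'cV[F]_N) : 'M_(k, t) :=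
  \matrix_(i, j) (rVpoly a^T)`_(i + j).

Lemma rVpoly_sum m (y : 'rV[F]_m) : rVpoly y = \sum_i y 0 i *: 'X^i.
Proof. by rewrite /rVpoly poly_def; apply: eq_bigr => i _; rewrite valK. Qed.

Lemma mul_tmx m n g (y : 'rV[F]_m) : y *m tmx g m n = poly_rV (rVpoly y * g).
Proof.
apply/rowP=> j; rewrite !mxE rVpoly_sum mulr_suml coef_sum.
by apply: eq_bigr => i _; rewrite !mxE -scalerAl coefZ.
Qed.

Lemma sum_tmx g d n i (f : nat -> F) : (size g <= d.+1)%N -> (i + d < n)%N ->
  \sum_(j < n) ('X^i * g)`_j * f j = \sum_(e < d.+1) g`_e * f (i + e)%N.
Proof.
move=> sg idn; rewrite -(big_mkord xpredT (fun j => ('X^i * g)`_j * f j)).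
rewrite (big_cat_nat (n := i)) //=; last by lia.
rewrite [X in X + _]big_nat big1 ?add0r; last first.
  by move=> j /andP[_ ji]; rewrite coefXnM ji mul0r.
rewrite -{1}[i]add0n big_addn (big_cat_nat (n := d.+1)) //=; last by lia.
rewrite [X in _ + X]big_nat [X in _ + X]big1 ?addr0; last first.
  move=> j /andP[dj _]; rewrite coefXnM ltnNge leq_addl /= addnK nth_default ?mul0r //.
  exact: leq_trans sg _.
rewrite big_mkord; apply: eq_bigr => e _.
by rewrite coefXnM ltnNge leq_addl /= addnK addnC.
Qed.

(** Combining consecutive rows with the coefficients of [g] keeps entries that depend on [i + l]
    only. A Hankel matrix restricted to multiples of [g] is thus again Hankel, for a shorter
    sequence. *)
Lemma tmx_mul_hank N k t m M d g (a : 'cV[F]_N) : (size g <= d.+1)%N ->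
  (k + t = N.+1)%N -> (m + d = k)%N -> (M + d = N)%N ->
  tmx g m k *m hank k t a = hank m t (tmx g M N *m a).
Proof.
move=> sg ktN mdk MdN; apply/matrixP=> i l; rewrite !mxE.
have ilM : (i + l < M)%N by have := ltn_ord i; have := ltn_ord l; lia.
rewrite (_ : (i + l)%N = Ordinal ilM) // coef_rVpoly_ord !mxE /=.
under eq_bigr do rewrite !mxE.
rewrite (sum_tmx (d := d) (fun j => (rVpoly a^T)`_(j + l))) //; last first.
  by rewrite -mdk ltn_add2r.
have aE (j : 'I_N) : a j 0 = (rVpoly a^T)`_j by rewrite coef_rVpoly_ord mxE.
under [RHS]eq_bigr => j _ do rewrite mxE aE.
rewrite (sum_tmx (d := d) (fun j => (rVpoly a^T)`_j)) //=; last by lia.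
by apply: eq_bigr => e _; rewrite addnAC.
Qed.

Lemma row_free_inj m n (A : 'M[F]_(m, n)) :
  (forall y : 'rV_m, y *m A = 0 -> y = 0) -> row_free A.
Proof.
move=> inj; rewrite -kermx_eq0; apply/eqP/row_matrixP=> i; rewrite row0.
by apply: inj; rewrite -row_mul mulmx_ker row0.
Qed.

Lemma rVpoly_inj m : injective (@rVpoly F m).
Proof. exact: can_inj rVpolyK. Qed.

Lemma size_rVpoly m (y : 'rV[F]_m) : (size (rVpoly y) <= m)%N.
Proof. exact: size_poly. Qed.

Lemma size_rVpoly_mul m n d g (y : 'rV[F]_m) : (size g <= d.+1)%N ->
  (m <= n - d)%N -> (size (rVpoly y * g)%R <= n)%N.
Proof.
move=> sg mn; have [nd|dn] := leqP n d; last first.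
  by rewrite -(subnK (ltnW dn)) size_mulD_le // (leq_trans (size_rVpoly y)).
have m0 : m = 0%N by move: mn; lia.
have /eqP -> : rVpoly y == 0 by rewrite -size_poly_eq0 -leqn0 -m0 size_rVpoly.
by rewrite mul0r size_poly0.
Qed.

Lemma row_free_tmx m n d g : (size g <= d.+1)%N -> g != 0 -> (m + d = n)%N ->
  row_free (tmx g m n).
Proof.
move=> sg g0 mdn; apply: row_free_inj => y; rewrite mul_tmx => /(congr1 rVpoly).
rewrite poly_rV_K ?linear0; last by apply: size_rVpoly_mul sg _; lia.
move/eqP; rewrite mulf_eq0 (negbTE g0) orbF => /eqP E.
by apply: rVpoly_inj; rewrite E linear0.
Qed.

(** Reversing the sequence turns a correlation into a product of polynomials. The reversed
    polynomial has constant coefficient 0, the default value of [a] at index [N]. *)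
Lemma mul_hank_coef N k t (a : 'cV[F]_N) (p : 'rV_k) (j : 'I_t) :
  (k + t = N.+1)%N ->
  (p *m hank k t a) 0 j = (rVpoly p * \poly_(i < N.+1) (rVpoly a^T)`_(N - i))`_(N - j).
Proof.
move=> ktN; rewrite mxE rVpoly_sum mulr_suml coef_sum; apply: eq_bigr => i _.
rewrite mxE -scalerAl coefZ coefXnM coef_poly.
have [ik jt] := (ltn_ord i, ltn_ord j).
have -> : (N - j < i)%N = false by lia.
have -> : (N - j - i < N.+1)%N by lia.
by congr (_ * _`_ _); lia.
Qed.

(** The lattice is built from [a] alone, so one pair [g], [h] serves the Hankel matrices of [a] of
    every shape. *)
Lemma hank_kernel_basis N (a : 'cV[F]_N) : exists d e g h,
  [/\ (d + e = N.+1)%N, (d <= e)%N, g != 0 /\ (size g <= d.+1)%N, (size h <= e.+1)%N &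
   (forall k m l, (k <= N.+1)%N -> (m <= k - d)%N -> (l <= k - e)%N ->
      row_free (col_mx (tmx g m k) (tmx h l k))) /\
   forall k t, (k + t = N.+1)%N ->
     (kermx (hank k t a) :=: col_mx (tmx g (k - d) k) (tmx h (k - e) k))%MS].
Proof.
(* Up to the order of its coefficients [B] is [a]; the kernel is made of the [p]
   for which [p * B] is congruent mod ['X^(N.+1)] to some [z] of size at most [k]. *)
pose B : {poly F} := \poly_(i < N.+1) (rVpoly a^T)`_(N - i).
have [g [z [h [w [d [e [rb den de]]]]]]] := @Xn_reduced_basis N.+1 B (leqW (size_poly _ _)).
have [sg sz sh sw m1 m2 [c c0 Edet]] := rb.
exists d, e, g, h; split=> //.
  split=> //; apply/eqP=> g0.
  have := @reduced_basis_free _ _ _ _ _ _ _ _ rb d.+1 1 0 _ _ _.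
  rewrite g0 mulr0 mul0r addr0 size_poly1 size_poly0 subSnn; case=> //; first by lia.
  by move/eqP; rewrite oner_eq0.
split=> [k m l kN mk lk|k t ktN].
  apply: row_free_inj => y; rewrite -[y]hsubmxK mul_row_col !mul_tmx -linearD.
  move=> /(congr1 rVpoly); rewrite linear0 poly_rV_K; last first.
    apply: leq_trans (size_polyD _ _) _.
    by rewrite geq_max !(size_rVpoly_mul _ sg, size_rVpoly_mul _ sh).
  case/(reduced_basis_free rb kN) => [||E1 E2]; try exact: leq_trans (size_rVpoly _) _.
  by rewrite (rVpoly_inj (etrans E1 (esym (linear0 _)))) (rVpoly_inj (etrans E2 (esym (linear0 _)))) row_mx0.
apply/eqmxP/andP; split; apply/rV_subP => p; last first.
  case/submxP=> y ->; apply/sub_kermxP; rewrite -[y]hsubmxK mul_row_col.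
  rewrite !mul_tmx -linearD; set u := rVpoly _; set v := rVpoly _.
  have su : (size (u * g)%R <= k)%N by apply: size_rVpoly_mul sg _.
  have sv : (size (v * h)%R <= k)%N by apply: size_rVpoly_mul sh _.
  have su' : (size (u * z)%R <= k)%N by apply: size_rVpoly_mul sz _.
  have sv' : (size (v * w)%R <= k)%N by apply: size_rVpoly_mul sw _.
  apply/rowP=> j; rewrite mul_hank_coef // -/B poly_rV_K; last first.
    by apply: leq_trans (size_polyD _ _) _; rewrite geq_max su.
  (* The entries are coefficients of degrees [k] to [N]: a multiple of ['X^(N.+1)] does not reach
     down to them, nor [u * z + v * w], of size at most [k], up to them. *)
  rewrite (_ : _ * B = u * (g * B - z) + v * (h * B - w) + (u * z + v * w)); last by ring.
  have jt := ltn_ord j.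
  have /dvdpP[q ->] : 'X^(N.+1) %| u * (g * B - z) + v * (h * B - w).
    by rewrite dvdp_add // dvdp_mull.
  rewrite coefD coefMXn ltnS leq_subr add0r nth_default ?mxE //.
  have kNj : (k <= N - j)%N by lia.
  apply: leq_trans kNj; apply: leq_trans (size_polyD _ _) _.
  by rewrite geq_max su'.
move/sub_kermxP=> p0.
(* The lattice vector over [p] has as second component [p * B] truncated below degree [k], since the
   coefficients from [k] to [N] vanish. *)
have [||u [v [su sv Ep]]] := @reduced_basis_span _ _ _ _ _ _ _ _ rb den
    (rVpoly p) (take_poly k (rVpoly p * B)) k (size_rVpoly p).
- exact: size_take_poly.
- rewrite -{1}(poly_take_drop k (rVpoly p * B)) addrC addKr.
  rewrite (_ : N.+1 = t + k)%N; last by rewrite addnC ktN.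
  rewrite exprD dvdp_mul // -(poly_take_drop t (drop_poly k _)).
  rewrite dvdp_add ?dvdp_mulIr //.
  rewrite (_ : take_poly _ _ = 0) ?dvdp0 //; apply/polyP=> i.
  rewrite coef_take_poly coef0; case: ifP => // it.
  have jt : (t - i.+1 < t)%N by lia.
  have := mul_hank_coef a p (Ordinal jt) ktN; rewrite p0 mxE -/B /=.
  rewrite coef_drop_poly => E; rewrite (_ : i + k = N - (t - i.+1))%N //; lia.
- apply/submxP; exists (row_mx (poly_rV u) (poly_rV v)).
  rewrite mul_row_col !mul_tmx !poly_rV_K // -linearD -Ep; exact/esym/rVpolyK.
Qed.

End HankelKernel.

(** * Fibres of linear maps over F_2, ranks of juxtaposed blocks, degree of a sequence *)

Local Notation F2 := 'F_2.

(** A row-free [T] is onto on columns and its fibres are translates of its kernel. This is the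
    equidistribution of the transformed sequences. *)
Lemma card_fibre M N (T : 'M[F2]_(M, N)) (P : pred 'cV[F2]_M) : row_free T ->
  #|[set a | P (T *m a)]| = (2 ^ (N - M) * #|[set c | P c]|)%N.
Proof.
move=> Tfree; pose z := #|[set a : 'cV_N | T *m a == 0]|.
have fib c : #|[set a : 'cV_N | T *m a == c]| = z.
  pose a0 := pinvmx T *m c.
  have Ta0 : T *m a0 = c by rewrite mulmxA mulmxVp // mul1mx.
  rewrite /z -[RHS](card_imset _ (@addIr _ a0)); apply: eq_card => a; rewrite inE.
  apply/idP/imsetP => [/eqP Ta|[a']].
    by exists (a - a0); rewrite ?subrK // inE mulmxBr Ta Ta0 subrr.
  by rewrite inE => /eqP Ta' ->; rewrite mulmxDr Ta' Ta0 add0r.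
have key (Q : pred 'cV[F2]_M) : #|[set a | Q (T *m a)]| = (#|[set c | Q c]| * z)%N.
  rewrite -!sum1dep_card big_distrl /= (partition_big (fun a => T *m a) Q) //=.
  apply: eq_bigr => c Qc; rewrite mul1n -(fib c) -sum1dep_card.
  by apply: eq_bigl => a; apply: andb_idl => /eqP->.
have MN : (M <= N)%N by rewrite -(eqP Tfree) rank_leq_col.
have := key xpredT.
have -> : [set a : 'cV[F2]_N | true] = setT by apply/setP=> x; rewrite !inE.
have -> : [set a : 'cV[F2]_M | true] = setT by apply/setP=> x; rewrite !inE.
rewrite !cardsT !card_mx !card_Fp // !muln1 => E.
rewrite key mulnC; congr (_ * _)%N; apply/eqP.
by rewrite -(@eqn_pmul2l (2 ^ M)) ?expn_gt0 // -expnD subnKC // E.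
Qed.

(** Rank-nullity for [B] on the left kernel of [A], since the kernel of the juxtaposition is the
    intersection of both kernels. *)
Lemma mxrank_row_mx (F : fieldType) m n p (A : 'M[F]_(m, n)) (B : 'M_(m, p)) :
  \rank (row_mx A B) = (\rank A + \rank (kermx A *m B))%N.
Proof.
have E : (kermx (row_mx A B) :=: kermx A :&: kermx B)%MS.
  apply/eqmxP/andP; split; apply/rV_subP => x; rewrite sub_capmx.
    move/sub_kermxP; rewrite mul_mx_row -row_mx0 => /eq_row_mx[? ?].
    by apply/andP; split; apply/sub_kermxP.
  case/andP=> /sub_kermxP xA /sub_kermxP xB; apply/sub_kermxP.
  by rewrite mul_mx_row xA xB row_mx0.
have := mxrank_mul_ker (kermx A) B; rewrite -(fst E) !mxrank_ker.
have := rank_leq_row (row_mx A B); have := rank_leq_row A.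
by lia.
Qed.

Lemma mxrank_row_mxC (F : fieldType) m n p (A : 'M[F]_(m, n)) (B : 'M_(m, p)) :
  \rank (row_mx A B) = \rank (row_mx B A).
Proof.
rewrite -mxrank_tr -[RHS]mxrank_tr !tr_row_mx -!addsmxE.
by rewrite addsmxC.
Qed.

Lemma tr_hank (F : fieldType) N k t (a : 'cV[F]_N) : (hank k t a)^T = hank t k a.
Proof. by apply/matrixP=> i j; rewrite !mxE addnC. Qed.

(* The least size (minus one) of a generator of the kernels of the Hankel matrices
   of [b], read off as the rank of the most square one. *)
Definition hdeg N (b : 'cV[F2]_N) : nat := \rank (hank (N.+1)./2 (uphalf N.+1) b).

(** At [k = (N.+1)./2] one has [d <= k <= e], so only [g] contributes to the kernel; its dimension
    is [k - d] and the rank is [d]. *)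
Lemma hank_kernel_hdeg N (b : 'cV[F2]_N) : exists e (g h : {poly F2}),
  [/\ (hdeg b + e = N.+1)%N, (hdeg b <= e)%N,
   g != 0 /\ (size g <= (hdeg b).+1)%N, (size h <= e.+1)%N &
   (forall k m l, (k <= N.+1)%N -> (m <= k - hdeg b)%N -> (l <= k - e)%N ->
      row_free (col_mx (tmx g m k) (tmx h l k))) /\
   forall k t, (k + t = N.+1)%N ->
     (kermx (hank k t b) :=: col_mx (tmx g (k - hdeg b) k) (tmx h (k - e) k))%MS].
Proof.
have [d [e [g [h [deN de sg sh [free ker]]]]]] := hank_kernel_basis b.
suff -> : hdeg b = d by exists e, g, h.
pose k := (N.+1)./2; have ktN : (k + uphalf N.+1)%N = N.+1.
  by rewrite uphalfE addnC -uphalfE uphalf_half -addnA addnn odd_double_half.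
have := fst (ker _ _ ktN); rewrite mxrank_ker (eqP (free _ _ _ _ _ _)) //; last by lia.
have := rank_leq_row (hank k (uphalf N.+1) b); rewrite -/(hdeg b) /k.
by lia.
Qed.

Lemma leq_hdeg N (b : 'cV[F2]_N) : ((hdeg b).*2 <= N.+1)%N.
Proof. by have [e [g [h []]]] := hank_kernel_hdeg b; lia. Qed.

Lemma rank_hank N k t (b : 'cV[F2]_N) : (k + t = N.+1)%N ->
  \rank (hank k t b) = minn (hdeg b) (minn k t).
Proof.
move=> ktN; have [e [g [h [deN de sg sh [free ker]]]]] := hank_kernel_hdeg b.
have := fst (ker _ _ ktN); rewrite mxrank_ker (eqP (free _ _ _ _ _ _)) //; last by lia.
by have := rank_leq_row (hank k t b); lia.
Qed.

(** * Counting the shorter sequence when the longer one is fixed *)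

Definition hank_count (N k t i : nat) : nat := #|[set a : 'cV[F2]_N | \rank (hank k t a) == i]|.

Definition dhank_count (N1 N2 t1 t2 k i : nat) : nat :=
  (\sum_(b : 'cV[F2]_N2)
    #|[set a : 'cV[F2]_N1 | \rank (row_mx (hank k t2 b) (hank k t1 a)) == i]|)%N.

Section FixedSecondBlock.

Variables (N1 N2 t1 t2 k : nat).
Hypotheses (kt1 : (k + t1 = N1.+1)%N) (kt2 : (k + t2 = N2.+1)%N).
Hypotheses (t1_gt0 : (0 < t1)%N) (t12 : (t1 <= t2)%N).
Variable b : 'cV[F2]_N2.

(** Here [e = k + t2 - hdeg b >= k], so the kernel of the block of [b] consists of multiples of [g]
    only. The factor is the size of the kernel of [a] mapped to its transform by [g]. *)
Lemma count_hdeg_small i : (hdeg b <= t2)%N -> (i < k)%N ->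
  #|[set a : 'cV[F2]_N1 | \rank (row_mx (hank k t2 b) (hank k t1 a)) == i]| =
  if (hdeg b <= i)%N then
    (2 ^ hdeg b * hank_count (N1 - hdeg b) (k - hdeg b) t1 (i - hdeg b))%N
  else 0%N.
Proof.
move=> dt2 ik; have rb := rank_hank b kt2.
under eq_finset => a do rewrite mxrank_row_mx rb.
have [id|di] := ltnP i (hdeg b).
  by apply/eqP; rewrite cards_eq0; apply/eqP/setP=> a; rewrite !inE; apply/eqP; lia.
have [e [g [h [deN de [g0 sg] sh [free ker]]]]] := hank_kernel_hdeg b.
have ke : (k - e = 0)%N by lia.
pose T := tmx g (N1 - hdeg b) N1.
pose P (c : 'cV[F2]_(N1 - hdeg b)) := \rank (hank (k - hdeg b) t1 c) == (i - hdeg b)%N.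
have /(card_fibre P) : row_free T by apply: (row_free_tmx sg) => //; lia.
rewrite (_ : (N1 - (N1 - hdeg b))%N = hdeg b); last by lia.
rewrite /hank_count => <-; apply: eq_card => a; rewrite !inE /P /T.
rewrite (fst (eqmxMr _ (ker _ _ kt2))) mul_col_mx.
rewrite (tmx_mul_hank (M := (N1 - hdeg b)%N) _ sg kt1); [|lia..].
set X := hank _ _ _; set Y := _ *m _.
have -> : \rank (col_mx X Y) = \rank X.
  rewrite -addsmxE; apply/eqmx_rank/andP; split; last exact: addsmxSl.
  rewrite addsmx_sub submx_refl; apply/row_subP=> y; have := ltn_ord y; by rewrite {2}ke.
by apply/eqP/eqP; lia.
Qed.

(** Now [k - e = hdeg b - t2 > 0] and both generators contribute. Transposing the two residual
    blocks gives a pair with [t1] common rows, to which the count applies again; the exponent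
    [t2.+1 - t1] is [N2.+1 - N1]. *)
Lemma count_hdeg_large i : (t2 < hdeg b)%N ->
  #|[set a : 'cV[F2]_N1 | \rank (row_mx (hank k t2 b) (hank k t1 a)) == i]| =
  if (t2 <= i)%N then
    (2 ^ (t2.+1 - t1) * dhank_count (N1 - (N2.+1 - hdeg b)) (N1 - hdeg b)
       (hdeg b - t2) (k - hdeg b) t1 (i - t2))%N
  else 0%N.
Proof.
move=> dt2; have rb := rank_hank b kt2.
have [e [g [h [deN de [g0 sg] sh [free ker]]]]] := hank_kernel_hdeg b.
have -> : (N2.+1 - hdeg b = e)%N by lia.
under eq_finset => a do rewrite mxrank_row_mx rb.
have [id|di] := ltnP i t2.
  by apply/eqP; rewrite cards_eq0; apply/eqP/setP=> a; rewrite !inE; apply/eqP; lia.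
pose T := col_mx (tmx g (N1 - hdeg b) N1) (tmx h (N1 - e) N1).
pose P (c : 'cV[F2]_(N1 - hdeg b + (N1 - e))) :=
  \rank (row_mx (hank t1 (k - hdeg b) (usubmx c)) (hank t1 (hdeg b - t2) (dsubmx c)))
    == (i - t2)%N.
(* Freeness of the basis is used here on [N1] coordinates, for the action on sequences, rather than
   on the [k] coordinates of kernel vectors. *)
have Tfree : row_free T by apply: free; lia.
rewrite (_ : t2.+1 - t1 = N1 - (N1 - hdeg b + (N1 - e)))%N; last by lia.
rewrite /dhank_count.
have -> : (\sum_(b0 : 'cV[F2]_(N1 - hdeg b)) #|[set a : 'cV[F2]_(N1 - e) | \rank (row_mx (hank t1 (k - hdeg b) b0)
    (hank t1 (hdeg b - t2) a)) == (i - t2)%N]| = #|[set c | P c]|)%N.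
    under eq_bigr do rewrite -sum1dep_card.
  rewrite pair_big_dep -sum1dep_card /=.
  rewrite (reindex (fun c : 'cV[F2]_(N1 - hdeg b + (N1 - e)) => (usubmx c, dsubmx c))) //=.
  exists (fun xy => col_mx xy.1 xy.2) => [c _|[x y] _] /=; first exact: vsubmxK.
  by rewrite col_mxKu col_mxKd.
rewrite -(card_fibre P Tfree); apply: eq_card => a; rewrite !inE /P /T mul_col_mx col_mxKu col_mxKd.
rewrite (fst (eqmxMr _ (ker _ _ kt2))) mul_col_mx.
rewrite (tmx_mul_hank (M := (N1 - hdeg b)%N) _ sg kt1); [|lia..].
rewrite (tmx_mul_hank (M := (N1 - e)%N) _ sh kt1); [|lia..].
rewrite -mxrank_tr tr_col_mx !tr_hank (_ : k - e = hdeg b - t2)%N; last by lia.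
rewrite (_ : minn _ _ = t2); last by lia.
by rewrite -[in LHS](subnKC di) eqn_add2l.
Qed.

End FixedSecondBlock.

(** * Number of sequences of each degree *)

Lemma mul_hank_tmx N k t (p : 'rV[F2]_k) (b : 'cV_N) : (k + t = N.+1)%N ->
  p *m hank k t b = (tmx (rVpoly p) t N *m b)^T.
Proof.
case: k p => [|k] p ktN; apply/rowP=> j; rewrite !mxE.
  rewrite big_ord0 big1 // => i _; rewrite mxE.
  have /eqP -> : rVpoly p == 0 by rewrite -size_poly_eq0 -leqn0 size_rVpoly.
  by rewrite mulr0 coef0 mul0r.
have bE (l : 'I_N) : b l 0 = (rVpoly b^T)`_l by rewrite coef_rVpoly_ord mxE.
under [RHS]eq_bigr => l _ do rewrite mxE bE.
rewrite (sum_tmx (d := k) (fun j => (rVpoly b^T)`_j)) ?size_rVpoly //; last first.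
  by have := ltn_ord j; lia.
by apply: eq_bigr => i _; rewrite mxE coef_rVpoly_ord addnC.
Qed.

Lemma card_ker m n (A : 'M[F2]_(m, n)) :
  #|[set p : 'rV_m | p *m A == 0]| = (2 ^ (m - \rank A))%N.
Proof.
have := card_rowg (kermx A); rewrite card_Fp // mxrank_ker => <-.
by apply: eq_card => p; rewrite inE mem_rowg; apply/eqP/sub_kermxP.
Qed.

(** Double counting of pairs [(p, b)]: [p = 0] allows every [b], and a nonzero [p] imposes [t]
    independent conditions, leaving [2 ^ (N - t)] sequences. *)
Lemma sum_ker_hank N k t : (k + t = N.+1)%N ->
  (\sum_(b : 'cV[F2]_N) 2 ^ (k - \rank (hank k t b)) =
   2 ^ N + (2 ^ k - 1) * 2 ^ k.-1)%N.
Proof.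
move=> ktN; under eq_bigr do rewrite -card_ker -sum1dep_card.
rewrite (exchange_big_dep xpredT) //= (bigD1 (0 : 'rV_k)) //=; congr (_ + _)%N.
  under eq_bigl => b do rewrite mul0mx eqxx.
  by rewrite sum1_card card_mx card_Fp // muln1.
rewrite (eq_bigr (fun _ => 2 ^ k.-1)%N).
  rewrite sum_nat_const; congr (_ * _)%N.
  have := cardC1 (0 : 'rV[F2]_k); rewrite card_mx card_Fp // mul1n -subn1 => <-.
  by apply: eq_card => p; rewrite !inE.
move=> p p0; rewrite sum1dep_card.
have k0 : (0 < k)%N.
  rewrite lt0n; apply: contraNneq p0 => k0; apply/eqP/rowP => i.
  by have := ltn_ord i; rewrite [X in (_ < X)%N]k0.
have Tfree : row_free (tmx (rVpoly p) t N).
  have sp : (size (rVpoly p) <= k.-1.+1)%N by rewrite prednK ?size_rVpoly.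
  apply: (row_free_tmx sp); last by lia.
  by apply: contraNneq p0 => P0; apply/eqP; apply: rVpoly_inj; rewrite P0 linear0.
rewrite (_ : k.-1 = N - t)%N; last by lia.
have := card_fibre (pred1 0) Tfree.
have -> : [set c : 'cV[F2]_t | pred1 0 c] = [set 0] by apply/setP=> c; rewrite !inE.
rewrite cards1 muln1 => <-; apply: eq_card => b; rewrite !inE mul_hank_tmx //.
by rewrite -(inj_eq (@trmx_inj _ _ _)) trmxK trmx0.
Qed.

(* With [X r] the sum of [sum_ker_hank] at [k = r], the indicator of [r < hdeg b]
   contributes [2 * X r - X r.+1]. *)
Lemma card_hdeg_gt N r : (r.*2 <= N)%N ->
  (#|[set b : 'cV[F2]_N | (r < hdeg b)%N]| + 4 ^ r = 2 ^ N)%N.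
Proof.
move=> rN; have e4 : (4 ^ r = 2 ^ r * 2 ^ r)%N by rewrite -expnMn.
have [{}rN|Nr] := ltnP r.*2 N; last first.
  rewrite (_ : [set _ | _] = set0) ?cards0.
    by rewrite (_ : N = r + r)%N ?expnD //; lia.
  by apply/setP=> b; rewrite !inE; apply/negbTE; have := leq_hdeg b; lia.
(* With [r.*2 < N] the shapes with [r] and [r.+1] rows are no taller than wide, so their kernels
   have the truncated dimensions [r - hdeg b] and [r.+1 - hdeg b]. *)
have ktN : (r + (N.+1 - r) = N.+1)%N by lia.
have ktN' : (r.+1 + (N - r) = N.+1)%N by lia.
have E : (\sum_(b : 'cV[F2]_N) 2 ^ (r.+1 - \rank (hank r.+1 (N - r) b)) +
   #|[set b : 'cV[F2]_N | (r < hdeg b)%N]| =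
   \sum_(b : 'cV[F2]_N) 2 * 2 ^ (r - \rank (hank r (N.+1 - r) b)))%N.
  rewrite -sum1dep_card [X in (_ + X)%N]big_mkcond -big_split /=.
  apply: eq_bigr => b _; rewrite !rank_hank //.
  case: ltnP => rd.
    have -> : (r.+1 - minn (hdeg b) (minn r.+1 (N - r)) = 0)%N by lia.
    by have -> : (r - minn (hdeg b) (minn r (N.+1 - r)) = 0)%N by lia.
  by rewrite addn0 -expnS; congr (2 ^ _)%N; lia.
move: E; rewrite -big_distrr /= !sum_ker_hank // e4 [r.+1.-1]/= expnS.
have := expn_gt0 2 r; case: r {e4 rN ktN ktN'} => [|r]; rewrite /= ?expnS; nia.
Qed.

(** * Sums over the degree and the recursion in rational form *)

Definition e2 (n : nat) : rat := 2%:R ^+ n.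

Lemma e2D m n : e2 (m + n) = e2 m * e2 n. Proof. exact: exprD. Qed.
Lemma e2_neq0 n : e2 n != 0. Proof. by rewrite expf_neq0. Qed.
Lemma e2S n : e2 n.+1 = 2%:R * e2 n. Proof. exact: exprS. Qed.
Lemma e2E n : (2 ^ n)%N%:R = e2 n. Proof. by rewrite natrX. Qed.

Lemma card_hdeg_gtr N r : (r.*2 <= N)%N ->
  #|[set b : 'cV[F2]_N | (r < hdeg b)%N]|%:R = e2 N - e2 r ^+ 2.
Proof.
move/card_hdeg_gt => /(congr1 (fun n => n%:R : rat)).
have -> : (4 ^ r = 2 ^ r * 2 ^ r)%N by rewrite -expnMn.
by rewrite natrD natrM !e2E -expr2 => <-; rewrite addrK.
Qed.

Lemma card_hdeg0 N : #|[set b : 'cV[F2]_N | hdeg b == 0%N]| = 1%N.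
Proof.
have := @card_hdeg_gt N 0 isT.
have := cardsC [set b : 'cV[F2]_N | hdeg b == 0%N].
rewrite card_mx card_Fp // muln1 (_ : ~: _ = [set b | (0 < hdeg b)%N]).
  by move=> E1; rewrite -E1 expn0 [LHS]addnC => /addIn.
by apply/setP=> b; rewrite !inE lt0n.
Qed.

Lemma card_hdegS N r : (r.+1.*2 <= N)%N ->
  #|[set b : 'cV[F2]_N | hdeg b == r.+1]|%:R = 3%:R * e2 r ^+ 2.
Proof.
move=> rN; apply: (addrI #|[set b : 'cV[F2]_N | (r.+1 < hdeg b)%N]|%:R).
rewrite -natrD -cardsUI (_ : _ :&: _ = set0); last first.
  by apply/setP=> b; rewrite !inE; apply/negbTE; lia.
rewrite cards0 addn0 (_ : _ :|: _ = [set b | (r < hdeg b)%N]); last first.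
  by apply/setP=> b; rewrite !inE; lia.
rewrite !card_hdeg_gtr ?e2S //; [ring|lia].
Qed.

(** The weights are the numbers of sequences of degree 0 and of degree [d.+1]. *)
Definition wsum (D : nat) (f : nat -> rat) : rat :=
  f 0%N + \sum_(0 <= d < D) 3%:R * e2 d ^+ 2 * f d.+1.

(** Beyond [D] only the total [2 ^ N - 4 ^ D] of sequences matters. This takes care of the largest
    degree, where the weight in [wsum] would be wrong for odd [N]. *)
Lemma sum_hdeg N D C (f : nat -> rat) : (D.*2 <= N)%N ->
  (forall d, (D < d)%N -> (d.*2 <= N.+1)%N -> f d = C) ->
  \sum_(b : 'cV[F2]_N) f (hdeg b) = wsum D f + C * (e2 N - e2 D ^+ 2).
Proof.
have sumC (x : rat) (P : pred 'cV[F2]_N) : \sum_(b | P b) x = #|[set b | P b]|%:R * x.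
  by rewrite big_const iter_addr_0 mulr_natl; congr (_ *+ _); apply: eq_card => b; rewrite inE.
elim: D f => [|D IH] f DN fC.
  rewrite /wsum big_geq // addr0 (bigID (fun b => hdeg b == 0%N)) /=.
  rewrite (eq_bigr (fun _ => f 0%N)); last by move=> b /eqP->.
  rewrite [X in _ + X](eq_bigr (fun _ => C)); last first.
    by move=> b b0; apply: fC; rewrite ?lt0n ?leq_hdeg.
  rewrite !sumC card_hdeg0 mul1r -card_hdeg_gtr // mulrC; congr (_ + _ * _%:R).
  by apply: eq_card => b; rewrite !inE lt0n.
(* With its value at [D.+1] replaced by [C], the function meets the induction hypothesis; the
   correction is weighted by [card_hdegS]. *)
pose f' d := if d == D.+1 then C else f d.
have f'C d : (D < d)%N -> (d.*2 <= N.+1)%N -> f' d = C.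
  by move=> Dd dN; rewrite /f'; case: eqP => // ne; apply: fC => //; lia.
have := IH f' _ f'C; rewrite doubleS in DN.
move=> /(_ ltac:(lia)) E.
have -> : \sum_(b : 'cV[F2]_N) f (hdeg b) = \sum_(b : 'cV[F2]_N) f' (hdeg b) +
    #|[set b : 'cV[F2]_N | hdeg b == D.+1]|%:R * (f D.+1 - C).
  rewrite -sumC [X in _ + X]big_mkcond -big_split /=; apply: eq_bigr => b _.
  by rewrite /f'; case: eqP => [->|_]; [rewrite addrC subrK | rewrite addr0].
rewrite E card_hdegS // /wsum big_nat_recr //= (_ : f' 0%N = f 0%N) //.
rewrite [X in _ + X + _ + _](eq_big_nat _ _ (F2 := fun d => 3%:R * e2 d ^+ 2 * f d.+1)); last first.
  by move=> d /andP[_ dD]; rewrite /f' eqSS ltn_eqF.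
by rewrite e2S; ring.
Qed.

(** For [j < k], rank [j < t] means degree [j], while rank [t] collects all degrees from [t] on. *)
Definition hank_card (k t j : nat) : rat :=
  if j == 0%N then 1 else if (j < t)%N then 3%:R * e2 j.-1 ^+ 2
  else if j == t then e2 (k + t).-1 - e2 t.-1 ^+ 2 else 0.

Lemma hank_countE N k t j : (k + t = N.+1)%N -> (j < k)%N -> (0 < t)%N ->
  (hank_count N k t j)%:R = hank_card k t j.
Proof.
move=> ktN jk t0; rewrite /hank_count /hank_card.
under eq_finset => b do rewrite rank_hank //.
have [->|j0] := eqVneq j 0%N.
  rewrite (_ : #|_| = 1%N) //; apply: etrans (card_hdeg0 N).
  by apply: eq_card => b; rewrite !inE; lia.
have [jt|tj] := ltnP j t.
  rewrite -(@card_hdegS N) ?prednK ?lt0n //; last by lia.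
  by congr _%:R; apply: eq_card => b; rewrite !inE; lia.
have [->|jt] := eqVneq j t; last first.
  rewrite (_ : [set _ | _] = set0) ?cards0 //; apply/setP=> b; rewrite !inE; lia.
rewrite ktN /= -card_hdeg_gtr; last by lia.
by congr _%:R; apply: eq_card => b; rewrite !inE; lia.
Qed.

Definition dhank_card (t1 t2 k i : nat) : rat :=
  (dhank_count (k + t1).-1 (k + t2).-1 t1 t2 k i)%:R.

(** The contribution of one [b] of degree [d], by [count_hdeg_small] and [count_hdeg_large]. *)
Definition gterm (t1 t2 k i d : nat) : rat :=
  if (d <= t2)%N then
    if (d <= i)%N then e2 d * hank_card (k - d) t1 (i - d) else 0
  else if (t2 <= i)%N then e2 (t2.+1 - t1) * dhank_card (d - t2) (k - d) t1 (i - t2)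
  else 0.

Lemma dhank_card_rec D C t1 t2 k i : (0 < t1)%N -> (t1 <= t2)%N -> (i < k)%N ->
  (D.*2 < k + t2)%N ->
  (forall d, (D < d)%N -> (d.*2 <= k + t2)%N -> gterm t1 t2 k i d = C) ->
  dhank_card t1 t2 k i = wsum D (gterm t1 t2 k i) + C * (e2 (k + t2).-1 - e2 D ^+ 2).
Proof.
move=> t10 t12 ik DN fC; have kt2 : (k + t2 = (k + t2).-1.+1)%N by lia.
have kt1 : (k + t1 = (k + t1).-1.+1)%N by lia.
rewrite -sum_hdeg; [|by lia|by move=> d Dd dN; apply: fC => //; lia].
rewrite /dhank_card /dhank_count natr_sum; apply: eq_bigr => b _; rewrite /gterm.
case: leqP => dt2.
  rewrite (count_hdeg_small kt1 kt2) //; case: leqP => // di.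
  by rewrite natrM e2E hank_countE //; lia.
rewrite (count_hdeg_large kt1 kt2) //; case: leqP => // t2i.
rewrite natrM e2E; congr (_ * _); have := leq_hdeg b => hb.
by congr (dhank_count _ _ _ _ _ _)%:R; lia.
Qed.

Lemma sum_e2 p n (c : rat) : (p <= n)%N ->
  \sum_(p <= d < n) c * e2 d = c * (e2 n - e2 p).
Proof.
move=> pn; rewrite -(subnKC pn); elim: (n - p)%N => [|m IH].
  by rewrite addn0 big_geq // subrr mulr0.
by rewrite addnS big_nat_recr ?leq_addr //= IH e2S; ring.
Qed.

Lemma sum_e2X r p n (c : rat) : (0 < r)%N -> (p <= n)%N ->
  \sum_(p <= d < n) c * e2 d ^+ r = c / (2%:R ^+ r - 1) * (e2 n ^+ r - e2 p ^+ r).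
Proof.
move=> r0 pn; have z0 : 2%:R ^+ r - 1 != 0 :> rat.
  by rewrite subr_eq0 gt_eqF // exprn_egt1 // -lt0n.
rewrite -(subnKC pn); elim: (n - p)%N => [|m IH].
  by rewrite addn0 big_geq // subrr mulr0.
by rewrite addnS big_nat_recr ?leq_addr //= IH e2S exprMn; field.
Qed.

(** * Closed forms for each range of the rank *)

Lemma dhank_card0 t1 t2 k : (0 < t1)%N -> (t1 <= t2)%N -> (0 < k)%N -> dhank_card t1 t2 k 0 = 1.
Proof.
move=> t10 t12 k0; rewrite (@dhank_card_rec 0 0) //; [|lia|].
  by rewrite /wsum big_geq // /gterm /hank_card /= mul0r !addr0 mulr1.
move=> d d0 _; rewrite /gterm; case: leqP => // dt2; case: ifP => //; lia.
Qed.

Lemma e2_pred n : (0 < n)%N -> e2 n.-1 = e2 n / 2%:R.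
Proof. by case: n => // n _; rewrite e2S; field. Qed.

(** The two degree counts, [3 * 4 ^ d] for [b] and [3 * 4 ^ (i - d - 2)] for the residual sequence,
    multiply to a constant, so the terms grow like [e2 d]. *)
Lemma gterm_mid t1 t2 k i d : (d.+1 < i)%N -> (d < t2)%N -> (i <= d + t1)%N ->
  3%:R * e2 d ^+ 2 * gterm t1 t2 k i d.+1 = 9%:R / 8%:R * e2 i ^+ 2 * e2 d.
Proof.
move=> di dt it; rewrite /gterm dt ltnW // /hank_card.
have -> : (i - d.+1 == 0)%N = false by lia.
have -> : (i - d.+1 < t1)%N by lia.
have -> : e2 i = e2 d * e2 (i - d.+1).-1 * 4%:R.
  by rewrite (_ : 4%:R = e2 2) // -!e2D; congr e2; lia.
by rewrite e2S; field.
Qed.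

Lemma gterm_top t1 t2 k i : (i < t2)%N ->
  3%:R * e2 i ^+ 2 * gterm t1 t2 k i.+1 i.+1 = 3%:R / 4%:R * e2 i.+1 ^+ 3.
Proof. by move=> it; rewrite /gterm it leqnn subnn /hank_card eqxx e2S; field. Qed.

(** The term of degree 0 is kept as [hank_card k t1 i], whose form depends on whether [i = t1]. *)
Lemma wsum_small t1 t2 k i : (0 < i)%N -> (i <= t1)%N -> (t1 <= t2)%N ->
  wsum i (gterm t1 t2 k i) =
  hank_card k t1 i + 21%:R / 16%:R * e2 i ^+ 3 - 9%:R / 8%:R * e2 i ^+ 2.
Proof.
case: i => // i _ it t12; rewrite /wsum big_nat_recr //= gterm_top //; last by lia.
rewrite (eq_big_nat _ _ (F2 := fun d => 9%:R / 8%:R * e2 i.+1 ^+ 2 * e2 d)).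
  by rewrite sum_e2 // /gterm /= !subn0 e2S (_ : e2 0 = 1) //; field.
by move=> d /andP[_ di]; apply: gterm_mid; lia.
Qed.

(** Degrees below [i - t1] would need a residual rank above [t1]. Degree [i - t1] needs the full
    residual rank [t1] and brings in [e2 k]; the later terms are geometric. *)
Lemma wsum_large t1 t2 k i n : (0 < t1)%N -> (t1 < i)%N -> (t1 <= t2)%N -> (i < k)%N ->
  (i - t1 <= n)%N -> (n < i)%N -> (n <= t2)%N ->
  wsum n (gterm t1 t2 k i) =
  3%:R / 8%:R * e2 k * e2 i ^+ 2 / e2 t1 - 21%:R / 16%:R * e2 i ^+ 3 / e2 t1
   + 9%:R / 8%:R * e2 i ^+ 2 * e2 n.
Proof.
move=> t10 ti t12 ik rn ni nt2; rewrite /wsum.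
have -> : gterm t1 t2 k i 0 = 0.
  rewrite /gterm /= !subn0 /hank_card; have -> : (i == 0)%N = false by lia.
  have -> : (i < t1)%N = false by lia.
  have -> : (i == t1) = false by lia.
  by rewrite mulr0.
rewrite add0r (big_cat_nat (n := (i - t1).-1)) //=; last by lia.
rewrite big_nat big1 ?add0r; last first.
  move=> d /andP[_ dr]; rewrite /gterm.
  have -> : (d < t2)%N by lia.
  have -> : (d < i)%N by lia.
  rewrite /hank_card; have -> : (i - d.+1 == 0)%N = false by lia.
  have -> : (i - d.+1 < t1)%N = false by lia.
  have -> : (i - d.+1 == t1)%N = false by lia.
  by rewrite !mulr0.
rewrite big_ltn; last by lia.
rewrite prednK; last by lia.
rewrite (eq_big_nat _ _ (F2 := fun d => 9%:R / 8%:R * e2 i ^+ 2 * e2 d)); last first.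
  by move=> d /andP[rd di]; apply: gterm_mid; lia.
rewrite sum_e2 // /gterm.
have -> : (i - t1 <= t2)%N by lia.
have -> : (i - t1 <= i)%N by lia.
have -> : (i - (i - t1) = t1)%N by lia.
rewrite /hank_card ltnn eqxx (_ : (t1 == 0)%N = false); last by lia.
have -> : e2 (k - (i - t1) + t1).-1 = e2 k * e2 t1 / e2 (i - t1) / 2%:R.
  rewrite e2_pred; last by lia.
  congr (_ / _); apply: (mulIf (e2_neq0 (i - t1))); rewrite divfK ?e2_neq0 // -!e2D.
  by congr e2; lia.
have -> : e2 i = e2 t1 * e2 (i - t1) by rewrite -e2D; congr e2; lia.
rewrite !e2_pred; [|lia..].
by field; rewrite !e2_neq0.
Qed.

Lemma dhank_card_lt_fst t1 t2 k i : (0 < i)%N -> (i < t1)%N -> (t1 <= t2)%N -> (i < k)%N ->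
  dhank_card t1 t2 k i = 21%:R / 16%:R * e2 i ^+ 3 - 3%:R / 8%:R * e2 i ^+ 2.
Proof.
move=> i0 it t12 ik; rewrite (@dhank_card_rec i 0); [|lia..|].
  rewrite wsum_small // ?(ltnW it) // /hank_card it (_ : (i == 0)%N = false); last by lia.
  by rewrite e2_pred //; field.
move=> d d0 _; rewrite /gterm; case: leqP => // dt2; case: ifP => //; lia.
Qed.

Lemma dhank_card_eq_fst t1 t2 k : (0 < t1)%N -> (t1 < t2)%N -> (t1 < k)%N ->
  dhank_card t1 t2 k t1 = e2 k * e2 t1 / 2%:R + 21%:R / 16%:R * e2 t1 ^+ 3
    - 11%:R / 8%:R * e2 t1 ^+ 2.
Proof.
move=> i0 t12 ik; rewrite (@dhank_card_rec t1 0); [|lia..|].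
  rewrite wsum_small // ?(ltnW t12) // /hank_card ltnn eqxx (_ : (t1 == 0)%N = false); last by lia.
  by rewrite !e2_pred ?e2D; [field|lia..].
move=> d d0 _; rewrite /gterm; case: leqP => // dt2; case: ifP => //; lia.
Qed.

(** The block of [b] already has rank [t2], so both transformed sequences vanish, and the number of
    such [a] is the same for all these degrees. *)
Lemma gterm_eq_snd t1 t2 k d : (0 < t1)%N -> (t1 <= t2)%N -> (t2 < d)%N ->
  (d.*2 <= k + t2)%N -> gterm t1 t2 k t2 d = 2%:R * e2 t2 / e2 t1.
Proof.
move=> t10 t12 t2d dk; rewrite /gterm leqNgt t2d /= leqnn subnn dhank_card0 //; [|lia..].
rewrite mulr1; apply: (mulIf (e2_neq0 t1)); rewrite divfK ?e2_neq0 // -e2S -e2D.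
by congr e2; lia.
Qed.

(** Equal blocks enter through the recursion for ranks above [t2], when [k - t2] is twice
    [i - t2]. *)
Lemma dhank_card_tie t k : (0 < t)%N -> (t < k)%N ->
  dhank_card t t k t = 3%:R / 2%:R * e2 k * e2 t + 21%:R / 16%:R * e2 t ^+ 3
    - 27%:R / 8%:R * e2 t ^+ 2.
Proof.
move=> t0 tk; rewrite (@dhank_card_rec t (2%:R * e2 t / e2 t)); [|lia..|]; last first.
  by move=> d td dk; apply: gterm_eq_snd.
rewrite wsum_small // /hank_card ltnn eqxx (_ : (t == 0)%N = false); last by lia.
by rewrite !e2_pred ?e2D; [field; rewrite e2_neq0|lia..].
Qed.

Lemma wsum_large_top t1 t2 k i : (0 < t1)%N -> (t1 < i)%N -> (i <= t2)%N -> (i < k)%N ->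
  wsum i (gterm t1 t2 k i) = 3%:R / 8%:R * e2 k * e2 i ^+ 2 / e2 t1 +
    21%:R / 16%:R * (e2 i ^+ 3 - e2 i ^+ 3 / e2 t1).
Proof.
move=> t10 ti it2 ik; case: i ti it2 ik => // i ti it2 ik.
rewrite /wsum big_nat_recr //= gterm_top // addrA -/(wsum i _).
rewrite wsum_large //; [|lia..].
by rewrite e2S; field; rewrite e2_neq0.
Qed.

Lemma dhank_card_between t1 t2 k i : (0 < t1)%N -> (t1 < i)%N -> (i < t2)%N -> (i < k)%N ->
  dhank_card t1 t2 k i = 3%:R / 8%:R * e2 k * e2 i ^+ 2 / e2 t1 +
    21%:R / 16%:R * (e2 i ^+ 3 - e2 i ^+ 3 / e2 t1).
Proof.
move=> t10 ti it2 ik; rewrite (@dhank_card_rec i 0); [|lia..|].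
  by rewrite wsum_large_top ?(ltnW it2) // mul0r addr0.
move=> d d0 _; rewrite /gterm; case: leqP => // dt2; case: ifP => //; lia.
Qed.

Lemma dhank_card_eq_snd t1 t2 k : (0 < t1)%N -> (t1 < t2)%N -> (t2 < k)%N ->
  dhank_card t1 t2 k t2 = 11%:R / 8%:R * e2 k * e2 t2 ^+ 2 / e2 t1 +
    21%:R / 16%:R * e2 t2 ^+ 3 - 53%:R / 16%:R * e2 t2 ^+ 3 / e2 t1.
Proof.
move=> t10 t12 tk; rewrite (@dhank_card_rec t2 (2%:R * e2 t2 / e2 t1)); [|lia..|]; last first.
  by move=> d td dk; apply: gterm_eq_snd => //; exact: ltnW.
rewrite wsum_large_top // e2_pred ?e2D; last by lia.
by field; rewrite e2_neq0.
Qed.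

Lemma wsum_high t1 t2 k i y : (t1 <= t2)%N -> (t2 <= i)%N ->
  wsum (t2 + y) (gterm t1 t2 k i) = wsum t2 (gterm t1 t2 k i) +
    6%:R * e2 t2 ^+ 3 / e2 t1 *
    \sum_(0 <= x < y) e2 x ^+ 2 * dhank_card x.+1 (k - t2 - x.+1) t1 (i - t2).
Proof.
move=> t12 t2i; rewrite /wsum (big_cat_nat (n := t2)) ?leq_addr //= addrA; congr (_ + _).
rewrite -{1}[t2]add0n big_addn addKn big_distrr /=; apply: eq_bigr => x _.
rewrite /gterm ltnNge leq_addl /= t2i (_ : (x + t2).+1 - t2 = x.+1)%N; last by lia.
rewrite (_ : k - (x + t2).+1 = k - t2 - x.+1)%N; last by lia.
have -> : e2 (t2.+1 - t1) = 2%:R * e2 t2 / e2 t1.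
  apply: (mulIf (e2_neq0 t1)); rewrite divfK ?e2_neq0 // -e2S -e2D; congr e2; lia.
by rewrite e2D; field; rewrite e2_neq0.
Qed.

(** The bounds on [y] keep [j] strictly between the block sizes [x.+1] and [n - x.+1], so a single
    closed form covers every term. *)
Lemma sum_dhank_card_between t n j y : (y < j)%N -> (y + j < n)%N -> (j < t)%N ->
  \sum_(0 <= x < y) e2 x ^+ 2 * dhank_card x.+1 (n - x.+1) t j =
  (3%:R / 16%:R * e2 t * e2 j ^+ 2 - 21%:R / 32%:R * e2 j ^+ 3) * (e2 y - 1) +
  7%:R / 16%:R * e2 j ^+ 3 * (e2 y ^+ 2 - 1).
Proof.
move=> yj yjn jt.
rewrite (eq_big_nat _ _ (F2 := fun x =>
  (3%:R / 16%:R * e2 t * e2 j ^+ 2 - 21%:R / 32%:R * e2 j ^+ 3) * e2 x +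
  21%:R / 16%:R * e2 j ^+ 3 * e2 x ^+ 2)); last first.
  move=> x /andP[_ xy]; rewrite dhank_card_between //; [|lia..].
  by rewrite e2S; field; rewrite e2_neq0.
by rewrite big_split /= sum_e2 // sum_e2X // (_ : e2 0 = 1) //; field.
Qed.

(* The value depends on [t1 + t2] only; hence the terms of the recursion are
   constant beyond the degree at which the sum over [hdeg] is cut. *)
Lemma dhank_card_gt_snd t1 t2 k i : (0 < t1)%N -> (t1 <= t2)%N -> (t2 < i)%N ->
  (i < t1 + t2)%N -> (i < k)%N ->
  dhank_card t1 t2 k i = 21%:R * (e2 k * e2 i ^+ 3 / (16%:R * e2 t1 * e2 t2)
    + e2 i ^+ 3 / 16%:R - 5%:R * e2 i ^+ 4 / (32%:R * e2 t1 * e2 t2)).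
Proof.
elim/ltn_ind: k => k IH in t1 t2 i *; move=> t10 t12 t2i iT ik.
have [j jE] : {j | i = (t2 + j)%N} by exists (i - t2)%N; lia.
have [n nE] : {n | k = (t2 + n)%N} by exists (k - t2)%N; lia.
pose A := 2%:R * e2 t2 / e2 t1.
have eA : e2 (t2.+1 - t1) = A.
  apply: (mulIf (e2_neq0 t1)); rewrite divfK ?e2_neq0 // -e2S -e2D; congr e2; lia.
have gtermE d : (t2 < d)%N -> gterm t1 t2 k i d = A * dhank_card (d - t2) (k - d) t1 j.
  move=> td; rewrite /gterm leqNgt td /= (ltnW t2i) eA; congr (_ * dhank_card _ _ _ _); lia.
have eN : e2 (k + t2).-1 = e2 n * e2 t2 ^+ 2 / 2%:R.
  by rewrite e2_pred ?nE ?e2D; [field|lia].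
have sum0 : wsum t2 (gterm t1 t2 k i) = 3%:R / 8%:R * e2 k * e2 i ^+ 2 / e2 t1
    - 21%:R / 16%:R * e2 i ^+ 3 / e2 t1 + 9%:R / 8%:R * e2 i ^+ 2 * e2 t2.
  by apply: wsum_large; lia.
have kt2 : (k - t2 = n)%N by lia.
have it2 : (i - t2 = j)%N by lia.
(* The inner block sizes are [d - t2] and [n] minus it, the first being the smaller; comparing [n]
   with [2 * j] tells which of them [j] meets first as [d] grows. *)
have [nj|jn] := leqP n (j + j).
  move: nj; rewrite leq_eqVlt => /orP[/eqP nj|nj].
  (* Both sizes reach [j] together, at the last degree [t2 + j]. *)
  - rewrite (@dhank_card_rec (t2 + j.-1) (A * dhank_card j j t1 j)); [|lia..|]; last first.
      move=> d Dd dk; rewrite gtermE; [congr (_ * dhank_card _ _ _ _)|]; lia.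
    rewrite wsum_high; [|lia..]; rewrite kt2 it2 sum_dhank_card_between; [|lia..].
    rewrite dhank_card_tie; [|lia..]; rewrite sum0 eN nE jE nj !e2D e2_pred; last by lia.
    by rewrite /A; field; rewrite !e2_neq0.
  (* The larger size falls to [j] at [d = t2 + (n - j)]; beyond, [j] exceeds both and the induction
     hypothesis applies with [t1] for [k]. *)
  - pose V := 21%:R * (e2 t1 * e2 j ^+ 3 / (16%:R * e2 n)
      + e2 j ^+ 3 / 16%:R - 5%:R * e2 j ^+ 4 / (32%:R * e2 n)).
    rewrite (@dhank_card_rec (t2 + (n - j)) (A * V)); [|lia..|]; last first.
      move=> d Dd dk; rewrite gtermE; last by lia.
      rewrite IH; [|lia..].
      rewrite /V (_ : e2 n = e2 (d - t2) * e2 (k - d)) ?mulrA //.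
      by rewrite -e2D; congr e2; lia.
    have [u uE] : {u | n = (u.+1 + j)%N} by exists (n - j.+1)%N; lia.
    rewrite wsum_high; [|lia..]; rewrite kt2 it2.
    rewrite (_ : n - j = u.+1)%N; last by lia.
    rewrite big_nat_recr //= sum_dhank_card_between; [|lia..].
    rewrite (_ : n - u.+1 = j)%N; last by lia.
    rewrite dhank_card_eq_snd; [|lia..].
    rewrite sum0 eN /V nE jE uE !e2D e2S /A.
    by field; rewrite !e2_neq0.
(* The smaller size rises to [j] at [d = t2 + j]; beyond, [j] is below both. *)
pose V := 21%:R / 16%:R * e2 j ^+ 3 - 3%:R / 8%:R * e2 j ^+ 2.
rewrite (@dhank_card_rec (t2 + j) (A * V)); [|lia..|]; last first.
  by move=> d Dd dk; rewrite gtermE ?dhank_card_lt_fst //; lia.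
have [u uE] : {u | j = u.+1} by exists j.-1; lia.
rewrite wsum_high; [|lia..]; rewrite kt2 it2 {1}uE big_nat_recr //= sum_dhank_card_between; [|lia..].
rewrite -uE dhank_card_eq_fst; [|lia..].
rewrite sum0 eN /V nE jE uE !e2D e2S /A.
by field; rewrite !e2_neq0.
Qed.

(** * Full rank by complement *)

Lemma sum_dhank_card t1 t2 k :
  \sum_(0 <= i < (t1 + t2).+1) dhank_card t1 t2 k i = e2 (k + t1).-1 * e2 (k + t2).-1.
Proof.
rewrite /dhank_card -natr_sum /dhank_count exchange_big /= -!e2E -natrM; congr _%:R.
rewrite (eq_bigr (fun _ => 2 ^ (k + t1).-1)%N).
  by rewrite sum_nat_const card_mx card_Fp // muln1 mulnC.
move=> b _; under eq_bigr do rewrite -sum1dep_card big_mkcond.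
rewrite exchange_big /= (eq_bigr (fun _ => 1%N)).
  by rewrite sum1_card card_mx card_Fp // muln1.
move=> a _; set r := \rank _.
have rT : (r < (t1 + t2).+1)%N by rewrite ltnS [X in (_ <= X)%N]addnC rank_leq_col.
rewrite -big_mkcond /= big_mkord (bigD1 (Ordinal rT)) //= big1 // => i.
by case/andP=> /eqP Er; rewrite -val_eqE /= Er eqxx.
Qed.

Lemma dhank_card_full t1 t2 k : (0 < t1)%N -> (t1 < t2)%N -> (t1 + t2 < k)%N ->
  dhank_card t1 t2 k (t1 + t2) = e2 k ^+ 2 * e2 t1 * e2 t2 / 4%:R
    - 3%:R / 16%:R * e2 k * (e2 t1 * e2 t2) ^+ 2 + (e2 t1 * e2 t2) ^+ 3 / 32%:R.
Proof.
move=> t10 t12 Tk.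
(* The exceptional ranks 0, [t1], [t2] cut the sum over smaller ranks into three geometric ranges;
   the divisors 3, 7 and 15 are the [2 ^ r - 1] of [sum_e2X]. *)
have S1 : \sum_(1 <= i < t1) dhank_card t1 t2 k i =
    21%:R / 16%:R / 7%:R * (e2 t1 ^+ 3 - 8%:R) - 3%:R / 8%:R / 3%:R * (e2 t1 ^+ 2 - 4%:R).
  transitivity (\sum_(1 <= i < t1)
      (21%:R / 16%:R * e2 i ^+ 3 + - (3%:R / 8%:R) * e2 i ^+ 2)).
    by apply: eq_big_nat => i /andP[i0 it]; rewrite dhank_card_lt_fst; [ring|lia..].
  rewrite big_split /= (sum_e2X _ (r := 3)) ?(sum_e2X _ (r := 2)); [|lia..].
  by rewrite (_ : e2 1 = 2%:R) //; field.
have S2 : \sum_(t1.+1 <= i < t2) dhank_card t1 t2 k i =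
    3%:R / 8%:R * e2 k / e2 t1 / 3%:R * (e2 t2 ^+ 2 - 4%:R * e2 t1 ^+ 2) +
    21%:R / 16%:R * (1 - (e2 t1)^-1) / 7%:R * (e2 t2 ^+ 3 - 8%:R * e2 t1 ^+ 3).
  transitivity (\sum_(t1.+1 <= i < t2) (3%:R / 8%:R * e2 k / e2 t1 * e2 i ^+ 2 +
      21%:R / 16%:R * (1 - (e2 t1)^-1) * e2 i ^+ 3)).
    apply: eq_big_nat => i /andP[i0 it]; rewrite dhank_card_between; [|lia..].
    by field; rewrite e2_neq0.
  rewrite big_split /= (sum_e2X _ (r := 3)) ?(sum_e2X _ (r := 2)); [|lia..].
  by rewrite e2S; field; rewrite e2_neq0.
have S3 : \sum_(t2.+1 <= i < t1 + t2) dhank_card t1 t2 k i =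
    21%:R * (e2 k / (16%:R * e2 t1 * e2 t2) + 16%:R^-1) / 7%:R
      * ((e2 t1 * e2 t2) ^+ 3 - 8%:R * e2 t2 ^+ 3)
    - 21%:R * 5%:R / (32%:R * e2 t1 * e2 t2) / 15%:R
      * ((e2 t1 * e2 t2) ^+ 4 - 16%:R * e2 t2 ^+ 4).
  transitivity (\sum_(t2.+1 <= i < t1 + t2)
      (21%:R * (e2 k / (16%:R * e2 t1 * e2 t2) + 16%:R^-1) * e2 i ^+ 3 +
       - (21%:R * 5%:R / (32%:R * e2 t1 * e2 t2)) * e2 i ^+ 4)).
    apply: eq_big_nat => i /andP[i0 it]; rewrite dhank_card_gt_snd; [|lia..].
    by field; rewrite !e2_neq0.
  rewrite big_split /= (sum_e2X _ (r := 3)) ?(sum_e2X _ (r := 4)); [|lia..].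
  by rewrite e2S e2D; field; rewrite !e2_neq0.
have := sum_dhank_card t1 t2 k; rewrite big_nat_recr; last by [].
rewrite (big_cat_nat (n := t2)) ?leq_addl; [|by []..].
rewrite (big_cat_nat (n := t1)) ?(ltnW t12); [|by []..].
rewrite big_ltn ?(@big_ltn _ _ _ t1 t2) ?(@big_ltn _ _ _ t2 (t1 + t2)%N); [|lia..].
rewrite S1 S2 S3 /= dhank_card0; [|lia..].
rewrite dhank_card_eq_fst ?dhank_card_eq_snd; [|lia..].
rewrite !e2_pred; [|lia..].
rewrite !(e2D k) => /(canRL (addKr _)) ->.
by field; rewrite !e2_neq0.
Qed.

(** * From persymmetric matrices to pairs of sequences *)

Lemma persymmetricP (T : eqType) m n (A : 'M[T]_(m, n)) :
  reflect (forall (i : 'I_m) (j : 'I_n) (i' : 'I_m) (j' : 'I_n), (i + j = i' + j')%N -> A i j = A i' j')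
    (A \in @persymmetric T m n).
Proof.
apply: (iffP idP) => [H i j i' j' E|H].
  move: H => /forallP/(_ i)/forallP/(_ j)/forallP/(_ i')/forallP/(_ j').
  by rewrite E eqxx => /eqP.
by apply/forallP=> i; apply/forallP=> j; apply/forallP=> i'; apply/forallP=> j';
  apply/implyP=> /eqP E; rewrite (H _ _ _ _ E).
Qed.

Lemma persymmetric_hank (F : fieldType) N m n (A : 'M[F]_(m, n)) :
  (m + n = N.+1)%N -> (0 < m)%N -> (0 < n)%N ->
  reflect (exists a : 'cV[F]_N, A = hank m n a) (A \in @persymmetric F m n).
Proof.
case: m A => // m; case: n => // n A mnN _ _.
apply: (iffP (persymmetricP A)) => [H|[a ->] i j i' j' E]; last by rewrite !mxE E.
(* Each antidiagonal is sampled down the first column, then along the last row. *)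
exists (\col_(l < N) A (inord (minn l m)) (inord (l - minn l m))).
apply/matrixP=> i j; rewrite mxE; have [im jn] := (ltn_ord i, ltn_ord j).
have ijN : (i + j < N)%N by lia.
rewrite (_ : (i + j)%N = Ordinal ijN) // coef_rVpoly_ord !mxE /=; apply: H.
by rewrite !inordK; lia.
Qed.

Lemma hank_inj (F : fieldType) N m n : (m + n = N.+1)%N -> (0 < m)%N -> (0 < n)%N ->
  injective (@hank F N m n).
Proof.
case: m => // m; case: n => // n mnN _ _ a b E; apply/colP=> l.
have lN := ltn_ord l.
have := congr1 (fun A : 'M_(_, _) => A (inord (minn l m)) (inord (l - minn l m))) E.
rewrite !mxE !inordK; [|lia..].
by rewrite subnKC ?geq_minl // !coef_rVpoly_ord !mxE.
Qed.

(** Nonempty blocks show every term of their sequences, so stacked matrices correspond to pairs of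
    sequences; transposition turns stacking into juxtaposition. *)
Lemma GammaE s m k i : (0 < s)%N -> (0 < k)%N -> (Gamma s m k i)%:R = dhank_card s (s + m) k i.
Proof.
move=> s0 k0; rewrite /dhank_card /dhank_count; congr _%:R.
have E1 : (s + k = (k + s).-1.+1)%N by lia.
have E2 : (s + m + k = (k + (s + m)).-1.+1)%N by lia.
have sm0 : (0 < s + m)%N by lia.
under eq_bigr do rewrite -sum1dep_card.
rewrite pair_big_dep /= sum1dep_card /Gamma.
pose f (ba : 'cV['F_2]_(k + (s + m)).-1 * 'cV['F_2]_(k + s).-1) :=
  col_mx (hank s k ba.2) (hank (s + m) k ba.1).
have f_inj : injective f.
  move=> [b a] [b' a'] /eq_col_mx[/= Ea Eb].
  by rewrite (hank_inj E1 s0 k0 Ea) (hank_inj E2 sm0 k0 Eb).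
have rank_f ba : \rank (f ba) = \rank (row_mx (hank k (s + m) ba.1) (hank k s ba.2)).
  by rewrite -mxrank_tr tr_col_mx !tr_hank mxrank_row_mxC.
rewrite -(card_imset _ f_inj); apply: eq_card => M; rewrite !inE.
apply/andP/imsetP => [[/imset2P[A B HA HB ->] rM]|[ba]]; last first.
  rewrite inE -rank_f => r ->; split=> //; apply/imset2P.
  exists (hank s k ba.2) (hank (s + m) k ba.1) => //.
    by apply/(persymmetric_hank _ E1 s0 k0); exists ba.2.
  by apply/(persymmetric_hank _ E2 sm0 k0); exists ba.1.
have /(persymmetric_hank _ E1 s0 k0)[a Ea] := HA.
have /(persymmetric_hank _ E2 sm0 k0)[b Eb] := HB.
by exists (b, a); rewrite ?inE -?rank_f /f -Ea -Eb.
Qed.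

(** * Integer exponents and the stated formulas *)

Lemma pow2D a b : pow2 (a + b) = pow2 a * pow2 b.
Proof. by rewrite /pow2 expfzDr. Qed.

Lemma pow2N a : pow2 (- a) = (pow2 a)^-1.
Proof. by rewrite /pow2 -invr_expz. Qed.

Lemma pow2_nat c : pow2 c%:R = 2%:R ^+ c.
Proof. by rewrite natz. Qed.

Lemma e2_1 : e2 1 = 2%:R.
Proof. exact: expr1. Qed.

Lemma pow2_Posz n : pow2 n%:Z = e2 n.
Proof. by []. Qed.

Lemma pow2M c n : pow2 (c%:R * n%:Z) = e2 n ^+ c.
Proof. by rewrite natz -PoszM /pow2 /e2 -exprM mulnC. Qed.

Theorem theorem2p13 (s m k i : nat) (hs : (1 <= s)%N) (hm : (2 <= m)%N) :
  let S := s%:Z in let M := m%:Z in let K := k%:Z in let I := i%:Z in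
  let G : rat := (Gamma s m k i)%:R in
  [/\ (i = 0)%N -> (1 <= k)%N -> G = 1,
      (1 <= i <= s - 1)%N -> (i < k)%N ->
        G = 21 * pow2 (3 * I - 4) - 3 * pow2 (2 * I - 3),
      (i = s)%N -> (s < k)%N ->
        G = pow2 (K + S - 1) + 21 * pow2 (3 * S - 4) - 11 * pow2 (2 * S - 3),
      (s + 1 <= i <= s + m - 1)%N -> (i < k)%N ->
        G = 3 * pow2 (K - S + 2 * I - 3)
            + 21 * (pow2 (3 * I - 4) - pow2 (3 * I - S - 4)) &
  [/\ (i = s + m)%N -> (s + m < k)%N ->
        G = 11 * pow2 (K + S + 2 * M - 3) + 21 * pow2 (3 * S + 3 * M - 4)
            - 53 * pow2 (2 * S + 3 * M - 4),
      (s + m + 1 <= i <= 2 * s + m - 1)%N -> (i < k)%N ->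
        G = 21 * (pow2 (K - 2 * S + 3 * I - M - 4) + pow2 (3 * I - 4)
                  - 5 * pow2 (4 * I - 2 * S - M - 5)) &
      (i = 2 * s + m)%N -> (2 * s + m < k)%N ->
        G = pow2 (2 * K + 2 * S + M - 2) - 3 * pow2 (K + 4 * S + 2 * M - 4)
            + pow2 (6 * S + 3 * M - 5)]].
Proof.
(* These rules turn each integer power into a rational monomial in values of [e2], which leaves
   identities for [field]. *)
pose pow2E := (pow2N, pow2M, pow2D, pow2_nat, pow2_Posz, e2_1).
move=> S M K I; rewrite /S /M /K /I => {S M K I}.
split=> [-> k0|/andP[i1 i2] ik|-> ik|/andP[i1 i2] ik|].
- by rewrite GammaE ?dhank_card0 //; lia.
- rewrite GammaE ?dhank_card_lt_fst; [|lia..].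
  by rewrite !pow2E; field.
- rewrite GammaE ?dhank_card_eq_fst; [|lia..].
  by rewrite !pow2E; field.
- rewrite GammaE ?dhank_card_between; [|lia..].
  by rewrite !pow2E; field; rewrite !e2_neq0.
split=> [-> ik|/andP[i1 i2] ik|-> ik].
- rewrite GammaE ?dhank_card_eq_snd; [|lia..].
  by rewrite !pow2E !e2D; field; rewrite !e2_neq0.
- rewrite GammaE ?dhank_card_gt_snd; [|lia..].
  by rewrite !pow2E !e2D; field; rewrite !e2_neq0.
- rewrite (_ : 2 * s + m = s + (s + m))%N; last by lia.
  rewrite GammaE ?dhank_card_full; [|lia..].
  by rewrite !pow2E !e2D; field.
Qed.
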